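(* (1) For $n\in\{3,4,5\}$, the isomorphism class of $\mathrm{Stab}_1(\mathrm{Sym}_n)$ is the only isomorphism class of perfect codes in the Star graph $S_n$. (2) The isomorphism classes of $\mathrm{Stab}_1(\mathrm{Sym}_6)$ and of $\mathrm{PGL}(2,5)$ are the only isomorphism classes of perfect codes in the Star graph $S_6$.
   Context: $\mathrm{Sym}_n$ is the symmetric group on $\{1,\ldots,n\}$ and $\mathrm{Stab}_1(\mathrm{Sym}_n)=\{\pi\in\mathrm{Sym}_n:\pi(1)=1\}$. For a group $G$ with an inverse-closed generating set $H$ not containing the identity, the Cayley graph $\Gamma(G,H)$ has vertex set $G$ and edge set $\{(hg,g): g\in G,\ h\in H\}$. The Star graph is $S_n=\Gamma(\mathrm{Sym}_n,\{(1\ i):2\le i\le n\})$; it is $(n-1)$-regular. A code in a graph is a subset $C$ of its vertices; its minimum distance is $\min_{x,y\in C,\,x\ne y}d(x,y)$, where $d$ is the graph distance. A code $C$ in a $k$-regular graph with vertex set $V$ is perfect if its minimum distance is $3$ and $|C|=|V|/(k+1)$. Two codes in a graph $\Gamma$ are isomorphic if there is an automorphism of the graph $\Gamma$ mapping one code onto the other; the isomorphism class of a code is the set of all codes isomorphic to it. $\mathrm{PGL}(2,5)$ is the projective linear group induced by the action of $\mathrm{GL}(2,5)$ on the six $1$-dimensional subspaces (projective points) of a $2$-dimensional vector space over the field with $5$ elements. The projective points are enumerated (by an arbitrary fixed bijection) by the elements of $\{1,\ldots,6\}$, so $\mathrm{PGL}(2,5)$ is a subgroup of $\mathrm{Sym}_6$.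 *)

(* Defs.v *)
From mathcomp Require Import all_boot all_algebra all_fingroup.
Set Implicit Arguments.
Unset Strict Implicit.
Unset Printing Implicit Defensive.

(* A graph on a finite type V is given by its adjacency relation e : rel V. *)

(* Length of a shortest e-walk from x to y. Shortest walks have length less
   than #|V|, so the value #|V| is taken exactly when y is not reachable. *)
Definition gdist (V : finType) (e : rel V) (x y : V) : nat :=
  find (fun d => [exists p : d.-tuple V, path e x p && (last x p == y)])
       (iota 0 #|V|).

Definition regular (V : finType) (e : rel V) (k : nat) : bool :=
  [forall x, #|[set y | e x y]| == k].

(* False for every d when C has fewer than two elements. *)
Definition has_min_dist (V : finType) (e : rel V) (C : {set V}) (d : nat) :
    bool :=
  [exists x in C, exists y in C, (x != y) && (gdist e x y == d)] &&
  [forall x in C, forall y in C, (x != y) ==> (d <= gdist e x y)].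

Definition perfect_code (V : finType) (e : rel V) (k : nat) (C : {set V}) :
    bool :=
  [&& regular e k, has_min_dist e C 3 & #|C| * k.+1 == #|V|].

Definition graph_aut (V : finType) (e : rel V) (f : {perm V}) : bool :=
  [forall x, forall y, e (f x) (f y) == e x y].

Definition isomorphic_codes (V : finType) (e : rel V) (C D : {set V}) : bool :=
  [exists f : {perm V}, graph_aut e f && (f @: C == D)].

Definition iso_class (V : finType) (e : rel V) (C : {set V}) : {set {set V}} :=
  [set D | isomorphic_codes e C D].

Definition perfect_code_classes (V : finType) (e : rel V) (k : nat) :
    {set {set {set V}}} :=
  [set iso_class e C | C : {set V} & perfect_code e k C].

Definition cayley (gT : finGroupType) (H : {set gT}) : rel gT :=
  fun x y => [exists h in H, x == (h * y)%g].

(* The points 1, ..., n are represented by 'I_n, so that the point 1 is the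
   index of value 0. *)

(* In 'S_n, (s * t) i = t (s i). For the opposite composition order one gets
   the image of this graph under s |-> s^-1, a map that fixes every subgroup. *)
Definition star (n : nat) : rel 'S_n :=
  cayley [set tperm i j | i in [set i : 'I_n | val i == 0],
                         j in [set j : 'I_n | val j != 0]].

Arguments star n : clear implicits.

Definition stab1 (n : nat) : {set 'S_n} :=
  [set s : 'S_n | [forall i : 'I_n, (val i == 0) ==> (s i == i)]].

Definition enumerates_points (F : finFieldType) (T : finType)
    (pt : T -> {vspace 'rV[F]_2}) : Prop :=
  injective pt /\ (forall U : {vspace 'rV[F]_2}, \dim U = 1 <-> exists i, pt i = U).

(* The permutations of the labels T induced by GL(2, F), where pt enumerates
   the projective points. *)
Definition PGL2 (F : finFieldType) (T : finType)
    (pt : T -> {vspace 'rV[F]_2}) : {set {perm T}} :=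
  [set s : {perm T} | [exists A : {'GL_2[F]},
     [forall i, pt (s i) == (linfun (mulmxr (GLval A)) @: pt i)%VS]]].

(* Main.v *)
Require Import Defs.
From mathcomp Require Import all_boot all_algebra all_fingroup.
Set Implicit Arguments.
Unset Strict Implicit.
Unset Printing Implicit Defensive.
Import GRing.Theory.

(* By counting, a perfect code is a set of (n-1)! permutations whose closed
   neighbourhoods are pairwise disjoint, hence partition the graph: an exact
   cover. Right translations are automorphisms, so one may assume that the code
   contains 1, and then an exhaustive exact cover search is small: it finds
   Stab_1 alone for n = 3, 4, 5, and for n = 6 also images of PGL(2, 5) under
   automorphisms s |-> a s a.
   For an arbitrary enumeration of the projective points, two elements of
   PGL(2, 5) that agree on three points are equal, which gives the minimum
   distance, and |GL(2, 5)| / 4 = 120 gives the size; this code must then be one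
   of those found by the search. It is not isomorphic to Stab_1, because 1 and
   (2 3) are joined by two geodesics of length 3, whereas two elements of
   PGL(2, 5) at distance 3 differ by a 4-cycle and are joined by only one. *)

(** * Exact covers by words *)

Notation word := (seq nat).

(* A set of words; the three fields of a node tell whether the empty word
   belongs to the set, which words [w] are such that [0 :: w] does, and which
   words [a :: w] are such that [a.+1 :: w] does. *)
Inductive trie := Empty | Node of bool & trie & trie.

Fixpoint tmem (t : trie) (w : word) : bool :=
  match t, w with
  | Empty, _ => false
  | Node b _ _, [::] => b
  | Node _ d _, 0 :: w' => tmem d w'
  | Node _ _ r, a.+1 :: w' => tmem r (a :: w')
  end.

Definition tfields (t : trie) : bool * trie * trie :=
  if t is Node b d r then (b, d, r) else (false, Empty, Empty).

(** Letters are encoded in unary along the third fields, whence a recursion on the letter nested in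
    the one on the word. *)
Fixpoint tadd (w : word) : trie -> trie :=
  if w is a :: w' then
    (fix add_at a t := let: (b, d, r) := tfields t in
       if a is a'.+1 then Node b d (add_at a' r) else Node b (tadd w' d) r) a
  else fun t => let: (_, d, r) := tfields t in Node true d r.

Lemma tmem_add w u t : tmem (tadd w t) u = (u == w) || tmem t u.
Proof.
elim: w u t => [|a w IHw] u t; first by case: t u => [|b d r] [|[|x] u].
elim: a u t => [|a IHa] u t.
  by case: t u => [|b d r] [|[|x] u] //=; rewrite IHw eqseq_cons ?orbF.
by case: t u => [|b d r] [|[|x] u] //=; move: (IHa (x :: u)) => /= ->;
  rewrite !eqseq_cons ?orbF.
Qed.

Definition tadds : trie -> seq word -> trie := foldr tadd.

Lemma tmem_adds t ws u : tmem (tadds t ws) u = (u \in ws) || tmem t u.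
Proof. by elim: ws => //= w ws IH; rewrite tmem_add IH inE orbA. Qed.

Definition select (v : word) (rows : seq (seq word)) : trie * seq (seq word) :=
  let tv := tadd v Empty in
  foldr (fun r p => if has (tmem tv) r then (tadds p.1 r, p.2)
                    else (p.1, r :: p.2))
    (Empty, [::]) rows.

Definition restrict (v : word) (rows : seq (seq word)) : seq (seq word) :=
  let: (t, rest) := select v rows in
  [seq [seq u <- r | ~~ tmem t u] | r <- rest].

Fixpoint shorter (r s : seq word) : bool :=
  match r, s with
  | _, [::] => false
  | [::], _ => true
  | _ :: r', _ :: s' => shorter r' s'
  end.

Definition shortest (r : seq word) (rows : seq (seq word)) : seq word :=
  foldl (fun s r => if shorter r s then r else s) r rows.

(* Knuth's Algorithm X: branch on the words of a shortest row; choosing [v]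
   removes the rows through [v], and all words of these rows elsewhere. Running
   out of [fuel] counts as a failure. *)
Fixpoint search (leaf : pred (seq word)) (fuel : nat) (chosen : seq word)
    (rows : seq (seq word)) : bool :=
  if fuel is fuel'.+1 then
    if rows is r :: rows' then
      all (fun v => search leaf fuel' (v :: chosen) (restrict v rows))
          (shortest r rows')
    else leaf chosen
  else false.

(** Adjacency being symmetric, the closed neighbourhood of a vertex lists the words that can cover
    it; a perfect code has exactly one of them. *)
Definition one_in (P : pred word) (r : seq word) : Prop :=
  has P r /\ {in r &, forall u v, P u -> P v -> u = v}.

Lemma selectP (P : pred word) v rows :
    {in rows, forall r, one_in P r} -> P v ->
  (forall u, tmem (select v rows).1 u -> P u -> u = v) /\
  {in (select v rows).2, forall r, r \in rows /\ v \notin r}.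
Proof.
move=> rowsP Pv; elim: rows rowsP => [|r rows IH] //= rowsP.
have [|IH1 IH2] := IH; first by move=> s sr; apply: rowsP; rewrite inE sr orbT.
have -> : has (tmem (tadd v Empty)) r = (v \in r).
  by rewrite -has_pred1; apply: eq_has => u; rewrite tmem_add orbF.
case: ifPn => vr /=; split.
- move=> u; rewrite tmem_adds => /orP[ur Pu|/IH1 //].
  by have [_] := rowsP r (mem_head _ _); apply.
- by move=> s /IH2[sr ->]; rewrite inE sr orbT.
- exact: IH1.
- move=> s; rewrite inE => /predU1P[->|/IH2[sr ->]]; first by rewrite mem_head.
  by rewrite inE sr orbT.
Qed.

(** The [P]-word of a surviving row is not erased: an erased one shares a row with [v], hence equals
    [v], which surviving rows avoid. *)
Lemma one_in_restrict (P : pred word) v rows :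
    {in rows, forall r, one_in P r} -> P v ->
  {in restrict v rows, forall r, one_in P r}.
Proof.
move=> rowsP Pv; have := selectP rowsP Pv.
rewrite /restrict; case: select => t rest /= [tP restP] s.
move=> /mapP[r /restP[rr vNr] ->]; have [/hasP[u ur Pu] uniq_r] := rowsP r rr.
split=> [|x y]; last first.
  by rewrite !mem_filter => /andP[_ xr] /andP[_]; apply: uniq_r.
apply/hasP; exists u => //; rewrite mem_filter ur andbT.
by apply: contra vNr => /tP <-.
Qed.

Lemma shortest_in r rows : shortest r rows \in r :: rows.
Proof.
rewrite /shortest; elim: rows r => [|s rows IH] r /=; first exact: mem_head.
case: ifP => _; have := IH s; have := IH r; rewrite !inE.
  by move=> _ ->; rewrite orbT.
by move=> /orP[->|->] _; rewrite ?orbT.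
Qed.

(** At each node follow a branch whose word satisfies [P]. Every row has such a word, so this path
    never dies, and as the search succeeds on all branches it ends at an accepted leaf. *)
Lemma searchP (P : pred word) leaf fuel chosen rows :
    search leaf fuel chosen rows -> all P chosen ->
    {in rows, forall r, one_in P r} ->
  exists2 ws, all P ws & leaf ws.
Proof.
elim: fuel chosen rows => //= fuel IH chosen [|r rows] srch chosenP rowsP.
  by exists chosen.
have [/hasP[v vr Pv] _] := rowsP _ (shortest_in r rows).
apply: (IH _ _ (allP srch v vr)); first by rewrite /= Pv.
exact: one_in_restrict.
Qed.

(** * Star graphs *)

Section GraphDistance.

Variables (V : finType) (e : rel V).

Let walk d x y := [exists p : d.-tuple V, path e x p && (last x p == y)].

Lemma gdist_walk x y : gdist e x y < #|V| -> walk (gdist e x y) x y.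
Proof.
rewrite /gdist -/(walk _ _ _) => ltV.
have hasW: has (fun d => walk d x y) (iota 0 #|V|).
  by rewrite has_find size_iota.
by have := nth_find 0 hasW; rewrite nth_iota.
Qed.

Lemma leq_gdist p x y :
  size p < #|V| -> path e x p -> last x p = y -> gdist e x y <= size p.
Proof.
move=> ltV ep lp; rewrite leqNgt; apply/negP => /(before_find 0).
rewrite nth_iota //= => /existsP[]; exists (in_tuple p).
by rewrite ep lp eqxx.
Qed.

Lemma ball1_of_gdist x y :
    2 < #|V| -> gdist e x y <= 2 ->
  [\/ x = y, e x y | exists2 z, e x z & e z y].
Proof.
move=> V2 le2; have := gdist_walk (leq_ltn_trans le2 V2).
case: (gdist e x y) le2 => [|[|[|d]]] // _ /existsP[[p sz]] /=.
- by case: p sz => //= _ /eqP; constructor 1.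
- case: p sz => [|u []] //= _; rewrite andbT => /andP[exu /eqP<-].
  by constructor 2.
- case: p sz => [|u [|v []]] //= _.
  by rewrite andbT => /andP[/andP[exu euv] /eqP<-]; constructor 3; exists u.
Qed.

Lemma isomorphic_refl C : isomorphic_codes e C C.
Proof.
apply/existsP; exists 1%g; apply/andP; split.
  by apply/'forall_forallP => x y; rewrite !perm1.
by apply/eqP/setP => x; rewrite (eq_imset _ (@perm1 V)) imset_id.
Qed.

Lemma isomorphic_sym C D : isomorphic_codes e C D -> isomorphic_codes e D C.
Proof.
case/existsP => f /andP[/'forall_forallP autf /eqP <-].
apply/existsP; exists f^-1%g; apply/andP; split.
  by apply/'forall_forallP => x y; rewrite -(eqP (autf _ _)) !permKV.
by apply/eqP; rewrite -imset_comp (eq_imset _ (permK f)) imset_id.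
Qed.

Lemma isomorphic_trans C D E :
  isomorphic_codes e C D -> isomorphic_codes e D E -> isomorphic_codes e C E.
Proof.
case/existsP => f /andP[/'forall_forallP autf /eqP <-].
case/existsP => g /andP[/'forall_forallP autg /eqP <-].
apply/existsP; exists (f * g)%g; apply/andP; split.
  by apply/'forall_forallP => x y; rewrite !permM (eqP (autg _ _)).
by apply/eqP; rewrite -imset_comp; apply: eq_imset => x; rewrite permM.
Qed.

Lemma iso_class_eqP C D :
  reflect (iso_class e C = iso_class e D) (isomorphic_codes e C D).
Proof.
apply: (iffP idP) => [CD | /setP/(_ D)]; last first.
  by rewrite !inE isomorphic_refl.
apply/setP => E; rewrite !inE; apply/idP/idP; last exact: isomorphic_trans.
exact/isomorphic_trans/isomorphic_sym.
Qed.

End GraphDistance.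

(** * Perfect codes as packings of maximal size, and automorphisms of the star graph *)

Section StarGraph.

Variable n : nat.
Implicit Types (x y z a b : 'S_n.+1) (C : {set 'S_n.+1}).

Local Notation swap j := (tperm (ord0 : 'I_n.+1) j).

Lemma starP x y :
  reflect (exists2 j, j != ord0 & x = (swap j * y)%g) (star n.+1 x y).
Proof.
apply: (iffP exists_inP) => [[h /imset2P[i j]]|[j j0 ->]].
  rewrite !inE => /eqP i0 j0 -> /eqP->; exists j => //.
  by congr (tperm _ _ * _)%g; apply: val_inj.
exists (swap j) => //; apply/imset2P; exists ord0 j => //; by rewrite inE.
Qed.

Lemma star_swap x j : j != ord0 -> star n.+1 x (swap j * x)%g.
Proof.
by move=> j0; apply/starP; exists j => //; rewrite mulgA tperm2 mul1g.
Qed.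

Lemma star_sym : symmetric (star n.+1).
Proof.
by move=> x y; apply/idP/idP => /starP[j j0 ->]; apply: star_swap.
Qed.

Lemma swap_inj : injective (fun j => swap j).
Proof.
by move=> i j /(congr1 (fun s : 'S_n.+1 => s ord0)); rewrite !tpermL.
Qed.

Lemma star_regular : regular (star n.+1) n.
Proof.
apply/forallP => x; apply/eqP.
have -> : [set y | star n.+1 x y] = [set swap j * x | j in ~: [set ord0]]%g.
  apply/setP => y; rewrite inE star_sym; apply/starP/imsetP => -[j].
    by move=> j0 ->; exists j => //; rewrite !inE.
  by rewrite !inE => j0 ->; exists j.
rewrite card_imset; last by move=> i j /mulIg/swap_inj.
by rewrite cardsC1 card_ord.
Qed.

(* The vertices [swap j * x] form the closed neighbourhood of [x], since
   [swap ord0] is the identity. *)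
Definition packing C := forall x y i j,
  x \in C -> y \in C -> (swap i * x = swap j * y)%g -> x = y.

Lemma packing_imset_inj C : packing C ->
  {in setX C [set: 'I_n.+1] &, injective (fun p => swap p.2 * p.1)%g}.
Proof.
move=> Cpack [x i] [y j]; rewrite !inE !andbT /= => Cx Cy eqxy.
have exy := Cpack _ _ _ _ Cx Cy eqxy; move: eqxy.
by rewrite exy => /mulIg/swap_inj ->.
Qed.

(** Sphere packing bound: disjoint balls of [n.+1] vertices among [(n.+1)!] vertices. In the case of
    equality the balls exhaust the group. *)
Lemma packing_card C : packing C -> #|C| <= n`!.
Proof.
move=> /packing_imset_inj/card_in_imset; rewrite cardsX cardsT card_ord => eqC.
have := max_card [in [set (swap p.2 * p.1)%g | p in setX C [set: 'I_n.+1]]].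
by rewrite eqC card_Sn factS mulnC leq_pmul2l.
Qed.

Lemma packing_cover C z :
  packing C -> #|C| = n`! -> exists2 x, x \in C & exists j, z = (swap j * x)%g.
Proof.
move=> Cpack Ccard; have := card_in_imset (packing_imset_inj Cpack).
rewrite cardsX cardsT card_ord Ccard mulnC -factS => eqn.
have : z \in [set (swap p.2 * p.1)%g | p in setX C [set: 'I_n.+1]].
  suff -> : [set (swap p.2 * p.1)%g | p in setX C [set: 'I_n.+1]] = setT.
    by rewrite inE.
  by apply/eqP; rewrite eqEcard subsetT cardsT card_Sn eqn leqnn.
case/imsetP => -[x j]; rewrite inE => /andP[Cx _] ->.
by exists x => //; exists j.
Qed.

Lemma card_Sn_gt3 : 1 < n -> 3 < #|'S_n.+1|.
Proof.
rewrite card_Sn; case: n => [|[|m]] // _; rewrite !factS mulnA.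
by rewrite (leq_trans (_ : 3 < 3 * 2 * 1)) // !leq_mul // muln_gt0 fact_gt0.
Qed.

(** The common vertex of the two balls is the midpoint of a walk; an index [ord0] drops one of its
    two steps. *)
Lemma gdist_swap x y i j : 1 < n ->
  (swap i * x = swap j * y)%g -> gdist (star n.+1) x y <= 2.
Proof.
move=> n1 eqxy; have V2 := ltnW (card_Sn_gt3 n1).
have [i0|i0] := eqVneq i ord0; have [j0|j0] := eqVneq j ord0;
  move: eqxy; rewrite ?i0 ?j0 ?tperm1 ?mul1g => eqxy.
- by rewrite (leq_trans (@leq_gdist _ _ [::] _ _ _ _ eqxy)) // card_Sn fact_gt0.
- apply: leq_trans (@leq_gdist _ _ [:: y] _ _ _ _ _) _; rewrite //= ?andbT.
    exact: leq_trans V2.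
  by apply/starP; exists j.
- apply: leq_trans (@leq_gdist _ _ [:: y] _ _ _ _ _) _; rewrite //= ?andbT.
    exact: leq_trans V2.
  by rewrite -eqxy star_swap.
- apply: leq_trans (@leq_gdist _ _ [:: swap i * x; y]%g _ _ _ _ _) _ => //=.
  by rewrite star_swap //= eqxy andbT star_sym star_swap.
Qed.

Lemma min_dist_packing C : 1 < n ->
  {in C &, forall x y, x != y -> 2 < gdist (star n.+1) x y} <-> packing C.
Proof.
move=> n1; split=> [distC x y i j Cx Cy eqxy | Cpack x y Cx Cy neqxy].
  apply: contraTeq isT => /(distC x y Cx Cy).
  by rewrite ltnNge (gdist_swap n1 eqxy).
rewrite ltnNge; apply: contra neqxy => le2; apply/eqP.
have V2 := ltnW (card_Sn_gt3 n1).
have [//|/starP[j _ exy]|[z /starP[i _ exz] /starP[j _ ezy]]] :=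
  ball1_of_gdist V2 le2.
  by apply: (Cpack x y ord0 j) => //; rewrite tperm1 mul1g.
by apply: (Cpack x y i j) => //; rewrite exz ezy mulgA tperm2 mul1g.
Qed.

Lemma perfect_codeP C : 1 < n ->
  reflect (packing C /\ #|C| = n`!) (perfect_code (star n.+1) n C).
Proof.
move=> n1; apply: (iffP and3P) => [[_ /andP[_ distC] cardC]|[Cpack Ccard]].
  split; last first.
    by apply/eqP; rewrite -(eqn_pmul2r (ltn0Sn n)) (eqP cardC) card_Sn mulnC.
  apply/(min_dist_packing _ n1) => x y Cx Cy; apply/implyP.
  by have /forall_inP/(_ x Cx)/forall_inP/(_ y Cy) := distC.
have distC := (min_dist_packing C n1).2 Cpack.
split; [exact: star_regular| |by rewrite Ccard card_Sn factS mulnC].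
apply/andP; split; last first.
  apply/forall_inP => x Cx; apply/forall_inP => y Cy; apply/implyP.
  exact: distC.
have /card_gt0P[x Cx] : 0 < #|C| by rewrite Ccard fact_gt0.
pose i1 : 'I_n.+1 := inord 1; pose i2 : 'I_n.+1 := inord 2.
have i10 : i1 != ord0 by rewrite -val_eqE /= inordK // ltnS ltnW.
have i20 : i2 != ord0 by rewrite -val_eqE /= inordK.
have i12 : i1 != i2 by rewrite -val_eqE /= !inordK // ltnS ltnW.
(* [z] is two steps from [x] and outside its ball, so the code word covering [z] is not [x] and lies
   at most three steps from [x]: the minimum distance 3 is attained. *)
pose z := (swap i1 * (swap i2 * x))%g.
have [y Cy [j ezy]] := packing_cover z Cpack Ccard.
apply/exists_inP; exists x => //; apply/exists_inP; exists y => //.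
have neqxy : x != y.
  apply: contraTneq isT => exy; move: ezy.
  rewrite /z -exy mulgA => /mulIg/permP eqs.
  have := eqs ord0; rewrite permM !tpermL tpermD 1?eq_sym // => i1j.
  have e12 : swap i1 i2 = i2 by rewrite tpermD // eq_sym.
  have := eqs i2; rewrite permM -i1j !e12 tpermR => /eqP.
  by rewrite eq_sym (negPf i20).
rewrite neqxy eqn_leq distC // andbT.
have V3 := card_Sn_gt3 n1.
have sxz : star n.+1 x (swap i2 * x)%g by rewrite star_swap.
have szz : star n.+1 (swap i2 * x)%g z by rewrite star_swap.
have [j0|j0] := eqVneq j ord0.
  move: ezy; rewrite j0 tperm1 mul1g => ezy.
  apply: leq_trans (@leq_gdist _ _ [:: swap i2 * x; z]%g _ _ _ _ _) _ => //=.
    exact: ltnW.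
  by rewrite sxz szz.
apply: leq_trans (@leq_gdist _ _ [:: swap i2 * x; z; y]%g _ _ _ _ _) _ => //=.
by rewrite sxz szz ezy star_sym star_swap.
Qed.

Definition aff a b x := (a * x * b)%g.

Lemma affK a b : cancel (aff a b) (aff a^-1 b^-1).
Proof. by move=> x; rewrite /aff !mulgA mulVg mul1g mulgK. Qed.

(** Moving [a] across a swap conjugates it, and the result is again a swap because [a] fixes
    [ord0]. *)
Lemma aff_swap a b j x :
  a ord0 = ord0 -> aff a b (swap (a j) * x) = (swap j * aff a b x)%g.
Proof.
move=> a0; rewrite /aff !mulgA; congr (_ * _ * _)%g.
by rewrite -{1}a0 -tpermJ conjgE !mulgA mulgV mul1g.
Qed.

Lemma star_aff a b x y :
  a ord0 = ord0 -> star n.+1 (aff a b x) (aff a b y) = star n.+1 x y.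
Proof.
have aff_star (u v s t : 'S_n.+1) : u ord0 = ord0 -> star n.+1 s t ->
    star n.+1 (aff u v s) (aff u v t).
  move=> u0 /starP[j j0 ->]; apply/starP; exists ((u^-1)%g j).
    by rewrite -(inj_eq (@perm_inj _ u)) permKV u0.
  by rewrite -aff_swap // permKV.
move=> a0; apply/idP/idP; last exact: aff_star.
by move/(@aff_star a^-1 b^-1)%g; rewrite !affK; apply; rewrite -{1}a0 permK.
Qed.

Lemma isomorphic_aff a b C :
  a ord0 = ord0 -> isomorphic_codes (star n.+1) C (aff a b @: C).
Proof.
move=> a0; apply/existsP; exists (perm (can_inj (affK a b))); apply/andP; split.
  by apply/'forall_forallP => x y; rewrite !permE star_aff.
by apply/eqP/eq_imset => x; rewrite permE.
Qed.

Lemma packing_aff a b C : a ord0 = ord0 -> packing C -> packing (aff a b @: C).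
Proof.
move=> a0 Cpack _ _ i j /imsetP[x Cx ->] /imsetP[y Cy ->].
by rewrite -!aff_swap // => /(can_inj (affK a b))/(Cpack x y _ _ Cx Cy) ->.
Qed.

End StarGraph.

(** * Permutations as words *)

Definition words (n : nat) : seq word := permutations (iota 0 n).

(** As in the product of ['S_n], the left factor acts first. *)
Definition wcomp (u v : word) : word := [seq nth 0 v i | i <- u].

Definition wswap (n : nat) (w : word) (j : nat) : word :=
  [seq nth 0 w (if i == 0 then j else if i == j then 0 else i) | i <- iota 0 n].

Definition wball (n : nat) (w : word) : seq word :=
  [seq wswap n w j | j <- iota 0 n].

(* The solution [ws] contains the image of some code of [codes] under the
   automorphism s |-> a * s * a, for some [a] in [fixers]. *)
Definition contains_code (fixers : seq word) (codes : seq (seq word))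
    (ws : seq word) : bool :=
  let t := tadds Empty ws in
  has (fun K => has (fun a => all (fun w => tmem t (wcomp (wcomp a w) a)) K)
                    fixers) codes.

(** The identity is chosen beforehand. The fuel exceeds the depth of any branch, since chosen words
    have disjoint balls and so number at most [(n-1)!]. *)
Definition only_codes (n : nat) (codes : seq (pred word)) : bool :=
  let W := words n in
  search
    (contains_code [seq a <- W | nth 0 a 0 == 0] [seq filter K W | K <- codes])
    n`! [:: iota 0 n] (restrict (iota 0 n) [seq wball n w | w <- W]).

Section Words.

Variable n : nat.
Implicit Types (s t a : 'S_n.+1) (C : {set 'S_n.+1}).

Local Notation swap j := (tperm (ord0 : 'I_n.+1) j).

Definition word_of s : word := [seq val (s i) | i <- enum 'I_n.+1].

Lemma size_word s : size (word_of s) = n.+1.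
Proof. by rewrite size_map size_enum_ord. Qed.

Lemma nth_word s (i : 'I_n.+1) : nth 0 (word_of s) i = s i.
Proof. by rewrite (nth_map i) ?size_enum_ord // nth_ord_enum. Qed.

Lemma word_inj : injective word_of.
Proof.
move=> s t eqst; apply/permP => i; apply: val_inj.
by rewrite /= -!nth_word eqst.
Qed.

Lemma word_ofM s t : word_of (s * t) = wcomp (word_of s) (word_of t).
Proof.
by rewrite /wcomp -map_comp; apply: eq_map => i; rewrite /= permM nth_word.
Qed.

Lemma word_of1 : word_of 1 = iota 0 n.+1.
Proof. by rewrite -val_enum_ord; apply: eq_map => i; rewrite perm1. Qed.

Lemma word_of_swap s (j : 'I_n.+1) :
  word_of (swap j * s) = wswap n.+1 (word_of s) j.
Proof.
rewrite /wswap -val_enum_ord -map_comp; apply: eq_map => i /=.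
rewrite permM -nth_word; congr nth.
case: tpermP => [->|->|/eqP i0 /eqP ij] //=; first by rewrite eqxx; case: eqP.
by rewrite -!val_eqE /= in i0 ij; rewrite (negPf i0) (negPf ij).
Qed.

Lemma wball_word s : wball n.+1 (word_of s) =
  [seq word_of (swap j * s) | j <- enum 'I_n.+1].
Proof.
rewrite /wball -val_enum_ord -map_comp; apply: eq_map => j.
by rewrite /= word_of_swap.
Qed.

Lemma wordsE w : (w \in words n.+1) = (w \in codom word_of).
Proof.
rewrite mem_permutations; apply/idP/codomP => [pw | [s ->]].
  have szw : size w = n.+1 by rewrite (perm_size pw) size_iota.
  have w_lt (i : 'I_n.+1) : nth 0 w i < n.+1.
    have : nth 0 w i \in iota 0 n.+1 by rewrite -(perm_mem pw) mem_nth ?szw.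
    by rewrite mem_iota.
  have inj_w : injective (fun i => Ordinal (w_lt i)).
    move=> i j [/eqP]; rewrite nth_uniq ?szw // => [/eqP/val_inj //|].
    by rewrite (perm_uniq pw) iota_uniq.
  exists (perm inj_w); apply: (@eq_from_nth _ 0); rewrite ?size_word // => i.
  by rewrite szw => lti; rewrite (nth_word _ (Ordinal lti)) permE.
have uniq_word t : uniq (word_of t).
  by rewrite map_inj_uniq ?enum_uniq // => i j /val_inj/perm_inj.
rewrite -word_of1; apply: uniq_perm => //.
move=> i; apply/mapP/mapP => -[j _ ->].
  by exists (s j); rewrite ?mem_enum ?perm1.
by exists ((s^-1)%g j); rewrite ?mem_enum ?perm1 ?permKV.
Qed.

Definition code_of (K : pred word) : {set 'S_n.+1} := [set s | K (word_of s)].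

Lemma card_code_of K : #|code_of K| = count K (words n.+1).
Proof.
rewrite -size_filter cardE -(size_map word_of); apply/perm_size/uniq_perm.
- by rewrite (map_inj_uniq word_inj) enum_uniq.
- by rewrite filter_uniq // permutations_uniq.
move=> w; rewrite mem_filter wordsE.
apply/mapP/andP => [[s]|[Kw /codomP[s ws]]].
  by rewrite mem_enum inE => Ks ->; rewrite codom_f.
by exists s; rewrite // mem_enum inE -ws.
Qed.

(** With [P] the words of [C], covering puts a code word in every ball and packing at most one, so
    [searchP] applies. The leaf test yields an inclusion only. *)
Lemma only_codesP (codes : seq (pred word)) C :
    only_codes n.+1 codes -> packing C -> #|C| = n`! -> 1%g \in C ->
  has (fun K => [exists a : 'S_n.+1, (a ord0 == ord0) &&
    [forall s in code_of K, a * s * a \in C]%g]) codes.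
Proof.
move=> srch Cpack Ccard C1; pose P w := w \in [seq word_of s | s in C].
have [] := searchP (P := P) srch.
- by rewrite -word_of1 /= /P image_f.
- apply: one_in_restrict => [r|]; last by rewrite /P -word_of1 image_f.
  case/mapP => w; rewrite wordsE => /codomP[s ->] ->.
  rewrite wball_word; split=> [|u v].
    have [x Cx [j sx]] := packing_cover s Cpack Ccard.
    apply/hasP; exists (word_of x); last exact: image_f.
    apply/mapP; exists j; first by rewrite mem_enum.
    by rewrite sx mulgA tperm2 mul1g.
  move=> /mapP[i _ ->] /mapP[j _ ->].
  rewrite /P !mem_map //; try exact: word_inj.
  rewrite !mem_enum => Ci Cj; congr word_of; apply: (Cpack _ _ i j) => //.
  by rewrite !mulgA !tperm2.
move=> ws wsP; rewrite /contains_code.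
rewrite has_map; apply: sub_has => K /= /hasP[a].
rewrite mem_filter wordsE => /andP[a0 /codomP[s as_]] /allP allK.
apply/existsP; exists s; rewrite -val_eqE /= -nth_word -as_ a0 /=.
apply/forall_inP => x; rewrite inE => Kx; have := allK (word_of x).
rewrite mem_filter Kx wordsE codom_f as_ -!word_ofM tmem_adds orbF.
by move=> /(_ isT)/(allP wsP); rewrite /P mem_map ?mem_enum //; apply: word_inj.
Qed.

(** A right translation brings the identity into the code; the inclusion found by the search is then
    an equality, both sides having [n!] elements. *)
Lemma isomorphic_code_of (codes : seq (pred word)) C :
    1 < n -> only_codes n.+1 codes ->
    all (fun K => count K (words n.+1) == n`!) codes ->
    perfect_code (star n.+1) n C ->
  has (fun K => isomorphic_codes (star n.+1) C (code_of K)) codes.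
Proof.
move=> n1 srch countK /(perfect_codeP _ n1)[Cpack Ccard].
have /card_gt0P[c Cc] : 0 < #|C| by rewrite Ccard fact_gt0.
have one0 : (1%g : 'S_n.+1) ord0 = ord0 by rewrite perm1.
have isoC := isomorphic_aff c^-1 C one0.
have cardC : #|aff 1 c^-1 @: C| = n`!.
  by rewrite card_imset //; apply: can_inj (affK _ _).
have := only_codesP srch (packing_aff (b := c^-1%g) one0 Cpack) cardC.
have -> : 1%g \in aff 1 c^-1 @: C.
  by apply/imsetP; exists c; rewrite // /aff mul1g mulgV.
move/(_ isT); elim: codes countK {srch} => //= K codes IH.
case/andP=> /eqP countK /IH{}IH.
case/orP=> [|/IH->]; last exact: orbT.
case/existsP=> a /andP[/eqP a0 /forall_inP aK]; apply/orP; left.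
apply: isomorphic_trans isoC _; apply: isomorphic_sym.
suff <- : aff a a @: code_of K = aff 1 c^-1 @: C by apply: isomorphic_aff.
apply/eqP; rewrite eqEcard; apply/andP; split.
  by apply/subsetP => _ /imsetP[s Ks ->]; apply: aK.
by rewrite cardC card_imset ?card_code_of ?countK //; apply: can_inj (affK _ _).
Qed.

Definition stab_word : pred word := fun w => nth 0 w 0 == 0.

Lemma code_of_stab : code_of stab_word = stab1 n.+1.
Proof.
apply/setP => s; rewrite !inE /stab_word (nth_word s ord0).
apply/eqP/forallP => [s0 i|/(_ ord0)/eqP s0].
  apply/implyP => /eqP i0; have -> : i = ord0 by apply: val_inj.
  by rewrite -val_eqE /= s0.
by rewrite s0.
Qed.

End Words.

(* PGL(2, 5) acting on 0, ..., 4 and the point at infinity, labelled 5: the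
   maps x |-> a x + b, then the maps x |-> a / (x - b) + c, where the inverse
   of y modulo 5 is y ^ 3. *)
Definition moebius_words : seq word :=
  [seq rcons [seq (a * x + b) %% 5 | x <- iota 0 5] 5
     | a <- iota 1 4, b <- iota 0 5] ++
  [seq rcons [seq if x == ab.2 then 5
                 else (ab.1 * (x + (5 - ab.2)) ^ 3 + c) %% 5
                | x <- iota 0 5] c
     | ab <- [seq (a, b) | a <- iota 1 4, b <- iota 0 5], c <- iota 0 5].

Definition moebius_word : pred word := fun w => w \in moebius_words.

(** * Searches and code sizes by computation *)

Lemma only_stab n : n \in [:: 3; 4; 5] -> only_codes n [:: stab_word].
Proof. by rewrite !inE => /or3P[] /eqP->; vm_compute. Qed.

Lemma count_stab n :
  n \in [:: 3; 4; 5; 6] -> count stab_word (words n) == n.-1`!.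
Proof. by rewrite !inE => /or4P[] /eqP->; vm_compute. Qed.

Lemma count_stab_moebius :
  all (fun K => count K (words 6) == 5`!) [:: stab_word; moebius_word].
Proof. by vm_compute. Qed.

Lemma only_stab_moebius : only_codes 6 [:: stab_word; moebius_word].
Proof. by vm_compute. Qed.

(** * PGL(2, 5) *)

Section ProjectiveLine.

Variable F : fieldType.
Implicit Types (u v w : 'rV[F]_2) (A B : 'M[F]_2).

Local Open Scope ring_scope.

(** A nonzero [x] would put [u] on the line of [v], and the two lines would coincide by
    dimension. *)
Lemma line_free u v (x y : F) :
  u != 0 -> <[u]>%VS != <[v]>%VS -> x *: u + y *: v = 0 -> x = 0.
Proof.
move=> u0 neq_uv /eqP; rewrite addr_eq0 => /eqP eqxy; apply/eqP.
apply: contraNT neq_uv => x0; rewrite eqEdim !dim_vline u0 leq_b1 andbT.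
rewrite -memvE; apply/vlineP; exists (- (x^-1 * y)).
by rewrite scaleNr -scalerA -scalerN -eqxy scalerA mulVf ?scale1r.
Qed.

Lemma line_span u v w : u != 0 -> <[u]>%VS != <[v]>%VS -> v != 0 ->
  exists x y, w = x *: u + y *: v.
Proof.
move=> u0 neq_uv v0.
have : (w \in <[u]> + <[v]>)%VS.
  suff -> : (<[u]> + <[v]>)%VS = fullv by apply: memvf.
  apply/eqP; rewrite eqEdim subvf dimvf /dim /= leqNgt.
  apply: contra neq_uv => dim1.
  have /eqP e : <[u]>%VS == (<[u]> + <[v]>)%VS.
    by rewrite eqEdim addvSl dim_vline u0.
  by rewrite eq_sym eqEdim !dim_vline u0 v0 andbT e addvSr.
by case/memv_addP=> _ /vlineP[x ->] [_ /vlineP[y ->] ->]; exists x, y.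
Qed.

(* Express [w] in terms of [u] and [v]: both coordinates are nonzero, so
   comparing the two values of [w *m A] gives a = c and b = c. *)
Lemma scale_of_three_lines A B u v w (a b c : F) : B \in unitmx ->
    u != 0 -> v != 0 -> w != 0 -> <[u]>%VS != <[v]>%VS ->
    <[u]>%VS != <[w]>%VS -> <[v]>%VS != <[w]>%VS ->
    u *m A = a *: (u *m B) -> v *m A = b *: (v *m B) ->
    w *m A = c *: (w *m B) ->
  A = a *: B.
Proof.
move=> uB u0 v0 w0 uv uw vw uA vA wA.
have [x [y wE]] := line_span w u0 uv v0.
have vu : <[v]>%VS != <[u]>%VS by rewrite eq_sym.
have x0 : x != 0.
  apply/eqP => x0; move: wE; rewrite x0 scale0r add0r => wE.
  have := @line_free w v 1 (- y) w0; rewrite eq_sym vw wE scale1r scaleNr subrr.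
  by move=> /(_ isT erefl)/eqP; rewrite oner_eq0.
have y0 : y != 0.
  apply/eqP => y0; move: wE; rewrite y0 scale0r addr0 => wE.
  have := @line_free w u 1 (- x) w0; rewrite eq_sym uw wE scale1r scaleNr subrr.
  by move=> /(_ isT erefl)/eqP; rewrite oner_eq0.
have comb : (x * (a - c)) *: u + (y * (b - c)) *: v = 0.
  apply: (can_inj (mulmxK uB)); rewrite mul0mx mulmxDl -!scalemxAl.
  rewrite -!scalerA !scalerBl !scalerBr -uA -vA !scalerA.
  move: wA; rewrite wE !mulmxDl -!scalemxAl scalerDr !scalerA => wA.
  by rewrite addrACA -opprD ![_ * c]mulrC -wA subrr.
have ac : a = c.
  apply/eqP; rewrite -subr_eq0.
  by have /eqP := line_free u0 uv comb; rewrite mulf_eq0 (negPf x0).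
have bc : b = c.
  apply/eqP; rewrite -subr_eq0; rewrite addrC in comb.
  by have /eqP := line_free v0 vu comb; rewrite mulf_eq0 (negPf y0).
(* [A] and [a *: B] agree on [u] and [v], which span, hence on the standard basis. *)
apply/row_matrixP => i; rewrite !rowE.
have [p [q ->]] := line_span (delta_mx 0 i) u0 uv v0.
rewrite !mulmxDl -!scalemxAl uA vA bc -ac.
by rewrite -!scalemxAr.
Qed.

End ProjectiveLine.

Section PGL2.

Variables (F : finFieldType) (T : finType) (pt : T -> {vspace 'rV[F]_2}).
Hypothesis ptP : enumerates_points pt.
Implicit Types (s t : {perm T}) (A B : {'GL_2[F]}).

Local Open Scope ring_scope.

Let dir i := vpick (pt i).

Lemma pt_line i : pt i = <[dir i]>%VS /\ dir i != 0.
Proof.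
have dim1 : \dim (pt i) = 1%N by apply/ptP.2; exists i.
have d0 : dir i != 0 by rewrite vpick0 -dimv_eq0 dim1.
split=> //; apply/eqP; rewrite eq_sym eqEdim dim_vline d0 dim1 andbT.
by rewrite -memvE memv_pick.
Qed.

Definition induces A s :=
  [forall i, pt (s i) == (linfun (mulmxr (GLval A)) @: pt i)%VS].

Lemma inducesP A s :
  reflect (forall i, pt (s i) = <[dir i *m GLval A]>%VS) (induces A s).
Proof.
have img i : (linfun (mulmxr (GLval A)) @: pt i)%VS = <[dir i *m GLval A]>%VS.
  by have [-> _] := pt_line i; rewrite limg_line lfunE.
by apply: (iffP forallP) => As i; have := As i; rewrite ?img => /eqP.
Qed.

Lemma PGL2P s : reflect (exists A, induces A s) (s \in PGL2 pt).
Proof. by rewrite inE; apply: existsP. Qed.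

(** At three common points the two images of a direction vector are proportional; three lines force
    one factor, nonzero as [A] is invertible. For [s = t] this describes the matrices inducing one
    permutation. *)
Lemma induces_agree A B s t :
    induces A s -> induces B t -> (2 < #|[set i | s i == t i]|)%N ->
  exists2 c : F, c != 0 & GLval A = c *: GLval B.
Proof.
move=> /inducesP As /inducesP Bt /card_gt2P[i [j [k [[]]]]].
rewrite !inE => /eqP si /eqP sj /eqP sk [ij jk ki].
have prop l : s l = t l -> exists a, dir l *m GLval A = a *: (dir l *m GLval B).
  by move=> sl; apply/vlineP; rewrite -Bt -sl As memv_line.
have neq l m : l != m -> <[dir l]>%VS != <[dir m]>%VS.
  have [<- _] := pt_line l; have [<- _] := pt_line m.
  by move=> lm; apply: contraNneq lm => /ptP.1 ->.
have dir0 l : dir l != 0 by have [] := pt_line l.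
have [a ai] := prop i si; have [b bj] := prop j sj; have [c ck] := prop k sk.
have AB := scale_of_three_lines (GL_unitmx B) (dir0 i) (dir0 j) (dir0 k)
  (neq _ _ ij) (neq i k _) (neq _ _ jk) ai bj ck.
exists a; last by apply: AB; rewrite eq_sym.
apply/eqP => a0; have := GL_det A; rewrite AB 1?eq_sym // a0 scale0r det0.
by rewrite eqxx.
Qed.

Lemma PGL2_sharp s t : s \in PGL2 pt -> t \in PGL2 pt ->
  (2 < #|[set i | s i == t i]|)%N -> s = t.
Proof.
move=> /PGL2P[A As] /PGL2P[B Bt] /(induces_agree As Bt)[c c0 AB].
move/inducesP: As => As; move/inducesP: Bt => Bt.
apply/permP => i; apply: ptP.1; rewrite As Bt AB -scalemxAr.
apply/eqP; rewrite eqEdim !dim_vline scaler_eq0 (negPf c0) leqnn andbT.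
by rewrite -memvE memvZ ?memv_line.
Qed.

Lemma induces_perm A : exists s, induces A s.
Proof.
have uA := GL_unitmx A.
have img_pt i : exists j, pt j = <[dir i *m GLval A]>%VS.
  apply/ptP.2; rewrite dim_vline; have [_ d0] := pt_line i.
  case: eqP => // /(congr1 (mulmx^~ (invmx (GLval A)))).
  by rewrite mulmxK // mul0mx => /eqP; rewrite (negPf d0).
have [f fE] := fin_all_exists img_pt.
have inj_f : injective f.
  move=> i j eqf; have := fE i; rewrite eqf fE => eqij; apply: ptP.1.
  have [-> di0] := pt_line i; have [-> dj0] := pt_line j.
  have /vlineP[c] : dir i *m GLval A \in <[dir j *m GLval A]>%VS.
    by rewrite eqij memv_line.
  rewrite scalemxAl => /(can_inj (mulmxK uA)) dij.
  apply/eqP; rewrite eqEdim !dim_vline di0 dj0 andbT dij.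
  by rewrite -memvE memvZ ?memv_line.
by exists (perm inj_f); apply/inducesP => i; rewrite permE.
Qed.

(** Each matrix is a nonzero multiple of the representative picked for its permutation, so a
    permutation comes from at most [#|F|.-1] matrices. *)
Lemma leq_card_GL2 : (2 < #|T| -> #|'GL_2[F]%g| <= #|PGL2 pt| * #|F|.-1)%N.
Proof.
move=> T2.
pose rep s := if [pick A | induces A s] is Some A then GLval A else 0.
rewrite cardsT -(card_imset _ (val_inj : injective GLval)) -(cardsC1 (0 : F)).
rewrite -cardsX.
apply: leq_trans (leq_imset_card (fun p => p.2 *: rep p.1) _).
apply/subset_leq_card/subsetP => _ /imsetP[A _ ->].
have [s As] := induces_perm A.
have sP : s \in PGL2 pt by apply/PGL2P; exists A.
have [B repB Bs] : exists2 B, rep s = GLval B & induces B s.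
  by rewrite /rep; case: pickP => [B Bs|/(_ A)]; [exists B | rewrite As].
have [|c c0 AB] := induces_agree As Bs.
  rewrite (leq_trans T2) // -cardsT.
  by apply/subset_leq_card/subsetP => i _; rewrite inE.
by apply/imsetP; exists (s, c); rewrite ?repB // in_setX sP !inE.
Qed.

End PGL2.

(** * Sets of permutations of six points determined by three values *)

Lemma agreement_off (s t : 'S_6) (l : seq 'I_6) :
  size l <= 3 -> {in [predC l], s =1 t} -> 2 < #|[set i | s i == t i]|.
Proof.
move=> szl st; have := cardC (mem l).
rewrite card_ord => eq6.
have le3 : #|l| <= 3 by apply: leq_trans (card_size l) szl.
have : #|[predC l]| <= #|[set i | s i == t i]|.
  by apply/subset_leq_card/subsetP => i li; rewrite inE st.
apply: leq_trans; rewrite -(leq_add2l #|l|) eq6.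
by rewrite (@leq_add #|l| 3 3 3).
Qed.

Section Sharp.

Variable C : {set 'S_6}.
Hypothesis sharp :
  {in C &, forall s t : 'S_6, 2 < #|[set i | s i == t i]| -> s = t}.

Local Notation swap j := (tperm (ord0 : 'I_6) j).

(** Elements whose balls meet agree off [ord0], [i], [j], hence on three of the six points. *)
Lemma sharp_packing : packing C.
Proof.
move=> x y i j Cx Cy eqxy; apply: sharp => //.
apply: (@agreement_off _ _ [:: ord0; i; j]) => // k.
rewrite !inE !negb_or => /and3P[k0 ki kj].
by move/permP/(_ k): eqxy; rewrite !permM !tpermD // eq_sym.
Qed.

(* With the points numbered from 0, the geodesics (0 1)(0 2)(0 1) and
   (0 2)(0 1)(0 2) from 1 to (1 2) start at different neighbours of 1. But the
   first neighbour [swap c * f 1] on the image of either one is determined by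
   the end points, as [f (1 2)] sends [c] to [f 1 ord0], unless the two ends
   agree on three points. *)
Lemma sharp_not_stab : ~~ isomorphic_codes (star 6) (stab1 6) C.
Proof.
apply/negP => /existsP[f /andP[/'forall_forallP autf /eqP fC]].
have step (u v : 'S_6) : star 6 u v -> exists j, f u = (swap j * f v)%g.
  by rewrite -(eqP (autf u v)) => /starP[j _ ->]; exists j.
pose i1 : 'I_6 := inord 1; pose i2 : 'I_6 := inord 2.
have i10 : i1 != ord0 by rewrite -val_eqE /= inordK.
have i20 : i2 != ord0 by rewrite -val_eqE /= inordK.
have i12 : i1 != i2 by rewrite -val_eqE /= !inordK.
have walk (i j : 'I_6) : i != ord0 -> j != ord0 -> i != j -> exists a b c,
    f (swap i) = (swap c * f 1)%g /\
    f (tperm i j) = (swap a * (swap b * (swap c * f 1)))%g.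
  move=> i0 j0 ij.
  have eqij : tperm i j = (swap i * (swap j * swap i))%g.
    rewrite -{1}[swap i]tpermV -/(conjg _ _) tpermJ tpermL tpermD //.
    by rewrite eq_sym.
  have [c ec] : exists j, f (swap i) = (swap j * f 1)%g.
    by apply: step; apply/starP; exists i; rewrite ?mulg1.
  have [b eb] : exists k, f (swap j * swap i)%g = (swap k * f (swap i))%g.
    by apply: step; apply/starP; exists j.
  have [a ea] : exists k, f (tperm i j) = (swap k * f (swap j * swap i))%g.
    by apply: step; apply/starP; exists i; rewrite // -eqij.
  by exists a, b, c; rewrite ea eb ec.
have Cf (s : 'S_6) : s ord0 = ord0 -> f s \in C.
  move=> s0; rewrite -fC imset_f // inE; apply/forallP => k; apply/implyP.
  by move=> /eqP k0; have -> : k = ord0; [apply: val_inj | rewrite s0].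
have C1 : f 1%g \in C by apply: Cf; rewrite perm1.
have C12 : f (tperm i1 i2) \in C by apply: Cf; rewrite tpermD.
have neq : f 1%g <> f (tperm i1 i2).
  move/perm_inj/permP/(_ i1); rewrite perm1 tpermL => /eqP.
  exact/negP.
have last_pt a b c : f (tperm i1 i2) = (swap a * (swap b * (swap c * f 1)))%g ->
    f (tperm i1 i2) c = f 1%g ord0.
  move=> e.
  (* If [ord0], [a], [b], [c] had a repetition, the two ends would agree on three points and be
     equal. So [c] differs from the others, and only the last swap applied moves it. *)
  have nonrep l : size l <= 3 -> {subset [:: ord0; a; b; c] <= l} -> False.
    move=> szl sub; apply: neq; apply: sharp => //.
    apply: (agreement_off szl) => k kl.
    have {kl} kN m : m \in [:: ord0; a; b; c] -> m != k.
      by move=> ml; apply: contraNneq kl => <-; apply: sub.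
    by rewrite e !permM !tpermD // kN // !inE eqxx ?orbT.
  have [ac bc] : a != c /\ b != c.
    split; apply/eqP => ex.
      apply: (nonrep [:: ord0; a; b]) => // m; rewrite -ex !inE.
      by case/or4P => ->; rewrite ?orbT.
    apply: (nonrep [:: ord0; a; b]) => // m; rewrite -ex !inE.
    by case/or4P => ->; rewrite ?orbT.
  have c0 : ord0 != c.
    apply/eqP => ex; apply: (nonrep [:: ord0; a; b]) => // m; rewrite -ex !inE.
    by case/or4P => ->; rewrite ?orbT.
  rewrite e !permM (tpermD c0 ac) (tpermD c0 bc) tpermR //.
have [a [b [c [ec e]]]] := walk i1 i2 i10 i20 i12.
have [|a' [b' [c' [ec' e']]]] := walk i2 i1 i20 i10; first by rewrite eq_sym.
(* Both geodesics have the same ends, and [c] is the preimage of [f 1 ord0] under the far end. *)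
have cc : c = c'.
  apply: (@perm_inj _ (f (tperm i1 i2))); rewrite (last_pt _ _ _ e).
  by rewrite tpermC in e'; rewrite (last_pt _ _ _ e').
have /perm_inj : f (swap i1) = f (swap i2) by rewrite ec ec' cc.
by move/swap_inj/eqP; apply/negP.
Qed.

End Sharp.

(** * The two perfect codes and the classification *)

Lemma PGL2_perfect (pt : 'I_6 -> {vspace 'rV['F_5]_2}) :
  enumerates_points pt -> perfect_code (star 6) 5 (PGL2 pt).
Proof.
move=> ptP; have pack : packing (PGL2 pt) by apply/sharp_packing/PGL2_sharp.
apply/perfect_codeP => //; split=> //; apply/eqP.
(* The packing bound gives at most 120 elements, and [GL(2, 5)], of order 480 = 120 * 4, gives at
   least 120. *)
rewrite eqn_leq packing_card //=.
have := leq_card_GL2 ptP; rewrite card_ord => /(_ isT).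
by rewrite card_GL_2 card_Fp // -[leqLHS]/(5`! * 4) leq_pmul2r.
Qed.

(** A product [swap i * x] with [x] fixing [ord0] sends exactly [i] to [ord0], so it determines [i]
    and then [x]. *)
Lemma perfect_stab n : 1 < n -> count stab_word (words n.+1) == n`! ->
  perfect_code (star n.+1) n (stab1 n.+1).
Proof.
move=> n1 /eqP cnt; apply/perfect_codeP => //; split; last first.
  by rewrite -code_of_stab card_code_of cnt.
move=> x y i j; rewrite -code_of_stab !inE /stab_word.
rewrite !(nth_word _ ord0) !(val_eqE _ (ord0 : 'I_n.+1)).
move=> /eqP x0 /eqP y0 eqxy.
have /permP/(_ i) := eqxy; rewrite !permM tpermR x0 -{1}y0 => /perm_inj.
rewrite -[X in X = _](tpermR ord0 j) => /perm_inj ji.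
by move: eqxy; rewrite ji => /mulgI.
Qed.

Theorem proposition2 :
  (forall n : nat, n \in [:: 3; 4; 5] ->
     perfect_code_classes (star n) n.-1 =
       [set iso_class (star n) (stab1 n)])
  /\
  (forall pt : 'I_6 -> {vspace 'rV['F_5]_2},
     enumerates_points pt ->
     perfect_code_classes (star 6) 5 =
       [set iso_class (star 6) (stab1 6); iso_class (star 6) (PGL2 pt)]
     /\ iso_class (star 6) (stab1 6) <> iso_class (star 6) (PGL2 pt)).
Proof.
split=> [n n345 | pt ptP].
  have only := only_stab n345.
  have cnt : count stab_word (words n) == n.-1`!.
    by apply: count_stab; move: n345; rewrite !inE => /or3P[] ->; rewrite ?orbT.
  have n1 : 1 < n.-1 by move: n345; rewrite !inE => /or3P[] /eqP->.
  case: n n1 only cnt {n345} => // n n1 only cnt.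
  apply/setP => K; rewrite inE; apply/imsetP/eqP => [[C] | ->]; last first.
    by exists (stab1 n.+1); rewrite // inE perfect_stab.
  rewrite inE => /(isomorphic_code_of n1 only); rewrite /= cnt orbF.
  by rewrite code_of_stab => /(_ isT)/iso_class_eqP-> ->.
have sharp := PGL2_sharp ptP.
have noniso := sharp_not_stab (fun s t => sharp s t).
split; last by move/iso_class_eqP; apply/negP.
have only C : perfect_code (star 6) 5 C -> isomorphic_codes (star 6) C (stab1 6)
    || isomorphic_codes (star 6) C (code_of 5 moebius_word).
  move=> Cperf.
  have /or3P[|->|//] := isomorphic_code_of (isT : 1 < 5) only_stab_moebius
    count_stab_moebius Cperf; last exact: orbT.
  by rewrite code_of_stab => ->.
have perfG := PGL2_perfect ptP.
(* The Moebius words are never compared with [PGL2 pt] directly: the latter is perfect and not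
   isomorphic to the stabilizer, which leaves only the other code of the search. *)
have isoG : isomorphic_codes (star 6) (code_of 5 moebius_word) (PGL2 pt).
  case/orP: (only _ perfG) => /isomorphic_sym //.
  by rewrite (negPf noniso).
apply/setP => K; rewrite !inE; apply/imsetP/orP => [[C] | [/eqP-> | /eqP->]].
- rewrite inE => /only/orP[/iso_class_eqP-> -> | isoC ->]; first by left.
  by right; apply/eqP/iso_class_eqP/(isomorphic_trans isoC).
- exists (stab1 6) => //; rewrite inE; apply: (perfect_stab (isT : 1 < 5)).
  exact: (@count_stab 6 isT).
- by exists (PGL2 pt); rewrite // inE.
Qed.
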